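(* Let $(\mathfrak X,\|\cdot\|)$ be a Banach space and let $\mu$ be a Borel probability measure on $\mathfrak X$ with $\int_{\mathfrak X}\|x\|\,\mu(dx)<\infty$. Then for every $N\in\mathbb N$ $$\varepsilon_N^{\mathrm{ran}}\ge\inf_{k\cdot n\le N}\max(e_n^{\mathrm{ran}},d_k),$$ where the infimum is over $k,n\in\mathbb N$ with $k\cdot n\le N$. Here $\varepsilon_N^{\mathrm{ran}}$ is the $N$-th minimal error of randomized algorithms in the real number model, $e_n^{\mathrm{ran}}$ is the $n$-th minimal error of broad sense randomized algorithms, and $d_k$ is the $k$-th average Kolmogorov width of $\mu$ of order one.
   Context: $\mathbb N=\{1,2,\dots\}$. $F$ denotes the class of all functionals $f:\mathfrak X\to\mathbb R$ with $|f(x)-f(y)|\le\|x-y\|$ for all $x,y\in\mathfrak X$, and $S(f)=\int_{\mathfrak X}f(x)\,\mu(dx)$ for $f\in F$. Deterministic algorithms. $\mathbb S^{\mathrm{det}}$ is the class of all mappings $\widehat S:F\to\mathbb R$ arising as follows from a point $x_1\in\mathfrak X$ and arbitrary mappings $\psi_\ell:\mathbb R^{\ell-1}\to\mathfrak X$ ($\ell\ge2$), $\tau_\ell:\mathbb R^\ell\to\{0,1\}$ ($\ell\ge1$), $\phi_\ell:\mathbb R^\ell\to\mathbb R$ ($\ell\ge1$). For $f\in F$ put $y_1=f(x_1)$ and $y_\ell=f(\psi_\ell(y_1,\dots,y_{\ell-1}))$ for $\ell\ge2$; let $n(f)=\min\{\ell\ge1:\tau_\ell(y_1,\dots,y_\ell)=1\}$,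 which is assumed to be finite for every $f\in F$; then $\widehat S(f)=\phi_{n(f)}(y_1,\dots,y_{n(f)})$. The mapping $\widehat S$ is identified with these data, and $\mathrm{card}(\widehat S,f)=n(f)$. Broad sense randomized algorithms. $\mathbb S^{\mathrm{ran}}$ is the class of all mappings $\widehat S:\Omega\times F\to\mathbb R$, on any probability space $(\Omega,\mathfrak A,P)$, such that (i) $\widehat S(\omega,\cdot)\in\mathbb S^{\mathrm{det}}$ for every $\omega\in\Omega$; (ii) $\widehat S(\cdot,f)$ is measurable for every $f\in F$; (iii) $\omega\mapsto\mathrm{card}(\widehat S(\omega,\cdot),f)$ is measurable for every $f\in F$. The random variables in (ii), (iii) are written $\widehat S(f)$ and $\mathrm{card}(\widehat S,f)$. Define $e(\widehat S)=\sup_{f\in F}(\mathbb E|S(f)-\widehat S(f)|^2)^{1/2}$ and $\mathrm{card}(\widehat S)=\sup_{f\in F}\mathbb E(\mathrm{card}(\widehat S,f))$ (for simplicity assumed to belong to $\mathbb N$), and $e_n^{\mathrm{ran}}=\inf\{e(\widehat S):\widehat S\in\mathbb S^{\mathrm{ran}},\ \mathrm{card}(\widehat S)\le n\}$. Real number model. A randomized algorithm (without the qualification ''broad sense'') is an element $\widehat S$ of $\mathbb S^{\mathrm{ran}}$ realized by a program that carries out exact computations with real numbers, has access to a perfect generator of random numbers from $[0,1]$ and to elementary functions ($\exp$, $\ln$, etc.), and has access to $f\in F$ only via an oracle that provides values $f(x)$ for points $x$ from a finite-dimensional linear subspace $\mathfrak X_0\subset\mathfrak X$; the subspace may be chosen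 arbitrarily but is fixed for a specific algorithm. The cost of a computation is $\dim(\mathfrak X_0)$ times the number of oracle calls, plus the total number of real number operations, calls of the random number generator and evaluations of elementary functions (in the case where $\mu$ is the distribution of a diffusion process, also plus the number of function evaluations of its drift and diffusion coefficients, which are then provided at cost one). $\mathrm{cost}(\widehat S)$ is the supremum over $f\in F$ of the expected cost of applying $\widehat S$ to $f$. Define $\varepsilon_N^{\mathrm{ran}}=\inf\{e(\widehat S):\widehat S\text{ randomized algorithm with }\mathrm{cost}(\widehat S)\le N\}$. Kolmogorov widths. $d_k=\inf\left\{\int_{\mathfrak X}\mathrm{dist}(x,\mathfrak X_0)\,\mu(dx):\mathfrak X_0\subset\mathfrak X\text{ linear subspace},\ \dim(\mathfrak X_0)=k\right\}$. *)

(* Defs.v *)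
From HB Require Import structures.
From mathcomp Require Import all_boot all_order all_algebra.
From mathcomp Require Import all_classical all_reals all_analysis.

Set Implicit Arguments.
Unset Strict Implicit.
Unset Printing Implicit Defensive.

Import Order.TTheory GRing.Theory Num.Theory.
Import numFieldNormedType.Exports.

Local Open Scope classical_set_scope.
Local Open Scope ring_scope.

Definition borelType {R : realType} (X : completeNormedModType R) :=
  g_sigma_algebraType (@open X).

Record lip1 {R : realType} (X : completeNormedModType R) := Lip1 {
  lip1_fun :> X -> R ;
  lip1P : forall x y, `|lip1_fun x - lip1_fun y| <= `|x - y| }.

Definition quad {R : realType} {X : completeNormedModType R}
  (mu : probability (borelType X) R) (f : lip1 X) : R := \int[mu]_x f x.

(* A family of maps on R^l, for all l, is encoded as one map on seq R; the    *)
(* values of det_psi, det_tau and det_phi at [::] are never used.             *)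
Record detdata {R : realType} (X : completeNormedModType R) := DetData {
  det_x1 : X ;
  det_psi : seq R -> X ;
  det_tau : seq R -> bool ;
  det_phi : seq R -> R }.

Section Deterministic.
Context {R : realType} {X : completeNormedModType R}.
Implicit Types (D : detdata X) (f : lip1 X).

Definition det_node D (ys : seq R) : X :=
  if ys is [::] then det_x1 D else det_psi D ys.

Fixpoint det_obs D f (l : nat) : seq R :=
  if l is m.+1 then rcons (det_obs D f m) (f (det_node D (det_obs D f m)))
  else [::].

Record detalg := DetAlg {
  det_data :> detdata X ;
  det_stop : forall f : lip1 X,
    exists l, (1 <= l)%N && det_tau det_data (det_obs det_data f l) }.

Definition det_card (A : detalg) f : nat := ex_minn (det_stop A f).

Definition det_eval (A : detalg) f : R := det_phi A (det_obs A f (det_card A f)).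

Definition det_nodes (A : detalg) f : seq X :=
  [seq det_node A (det_obs A f l) | l <- iota 0 (det_card A f)].

End Deterministic.
Arguments detalg {R} X.

Definition expected_card {R : realType} {X : completeNormedModType R}
    (d : measure_display) (T : measurableType d) (P : probability T R)
    (alg : T -> detalg X) : \bar R :=
  ereal_sup (range (fun f : lip1 X => ('E_P[fun w => (det_card (alg w) f)%:R%R])%E)).

Record ranalg {R : realType} (X : completeNormedModType R) := RanAlg {
  ran_disp : measure_display ;
  ran_T : measurableType ran_disp ;
  ran_P : probability ran_T R ;
  ran_alg :> ran_T -> detalg X ;
  ran_eval_meas : forall f,
    measurable_fun [set: ran_T] (fun w => det_eval (ran_alg w) f) ;
  ran_card_meas : forall f,
    measurable_fun [set: ran_T] (fun w => det_card (ran_alg w) f) ;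
  ran_card_nat : exists2 n : nat, (1 <= n)%N &
    expected_card ran_P ran_alg = n%:R%:E }.

Definition ran_card {R : realType} {X : completeNormedModType R}
  (A : ranalg X) : \bar R := expected_card (ran_P A) A.

Definition ran_err {R : realType} {X : completeNormedModType R}
    (mu : probability (borelType X) R) (A : ranalg X) : \bar R :=
  ereal_sup (range (fun f : lip1 X =>
    (('E_(ran_P A)[fun w => (`|quad mu f - det_eval (A w) f| ^+ 2)%R]) `^ (2^-1)%R)%E)).

Definition e_ran {R : realType} {X : completeNormedModType R}
    (mu : probability (borelType X) R) (n : nat) : \bar R :=
  ereal_inf [set e | exists2 A : ranalg X,
    (ran_card A <= n%:R%:E)%E & e = ran_err mu A].

Section Widths.
Context {R : realType} {X : completeNormedModType R}.

Definition lin_comb (k : nat) (b : 'I_k -> X) (c : 'I_k -> R) : X :=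
  \sum_(i < k) c i *: b i.

Definition lin_indep (k : nat) (b : 'I_k -> X) : Prop :=
  forall c : 'I_k -> R, lin_comb b c = 0 -> forall i, c i = 0.

Definition subspace_of_dim (k : nat) (X0 : set X) : Prop :=
  exists2 b : 'I_k -> X, lin_indep b & X0 = range (lin_comb b).

Definition dist_to (X0 : set X) (x : X) : R := inf [set `|x - y| | y in X0].

(* If k exceeds the dimension of X, the infimum is over the empty set and has *)
(* the value 0 (inf set0 = 0), which is also the width for k = dim X.         *)
Definition kwidth (mu : probability (borelType X) R) (k : nat) : R :=
  inf [set \int[mu]_x dist_to X0 x | X0 in subspace_of_dim k].

End Widths.

(* Extra functions R^m -> R^p that a program may evaluate at unit cost: the   *)
(* drift and diffusion coefficients of a diffusion process, or elementary     *)
(* functions not listed in [elem].                                            *)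
Record unit_fun (R : realType) := UnitFun {
  uf_in : nat ;
  uf_out : nat ;
  uf_map : uf_in.-tuple R -> uf_out.-tuple R }.

Inductive arith := Add | Sub | Mul | Div.

Definition arith_sem {R : realType} (o : arith) (x y : R) : R :=
  match o with
  | Add => x + y
  | Sub => x - y
  | Mul => x * y
  | Div => x / y
  end.

Inductive elem := Exp | Ln | Sqrt | Sin | Cos | Tan | Asin | Acos | Atan.

Definition elem_sem {R : realType} (e : elem) (x : R) : R :=
  match e with
  | Exp => expR x
  | Ln => ln x
  | Sqrt => Num.sqrt x
  | Sin => sin x
  | Cos => cos x
  | Tan => tan x
  | Asin => asin x
  | Acos => acos x
  | Atan => atan x
  end.

(* The machine has an infinite array of real registers, addressed directly    *)
(* ([Dir n]) or through the content of an index register ([Ind j]), and       *)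
(* natural-number index registers for loop counters and address arithmetic.   *)
Inductive addr := Dir of nat | Ind of nat.

Inductive instr (R : realType) (I : Type) :=
  | IConst of addr & R
  | ICopy of addr & addr
  | IArith of arith & addr & addr & addr
  | IElem of elem & addr & addr
  | IUnit of I & addr & addr
  | IRand of addr
  | IQuery of addr & addr
  | IJumpLt of addr & addr & nat
  | IJump of nat
  | IIdxSet of nat & nat
  | IIdxSucc of nat
  | IIdxPred of nat
  | IIdxJumpZero of nat & nat
  | IHalt of addr.

Record config (R : realType) (X : completeNormedModType R) := Config {
  c_pc : nat ;
  c_reg : nat -> R ;
  c_idx : nat -> nat ;
  c_rand : nat ;       (* random numbers consumed so far *)
  c_queries : seq X ;  (* points passed to the oracle so far *)
  c_ops : nat }.       (* unit-cost steps so far, oracle calls excluded *)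

Section Machine.
Context {R : realType} {X : completeNormedModType R} {I : Type}.
Variables (uf : I -> unit_fun R) (k : nat) (b : 'I_k -> X).
Variable prog : seq (instr R I).
(* The random numbers delivered by successive calls of the generator.         *)
Variables (f : lip1 X) (u : nat -> R).
Implicit Type c : config X.

Definition loc c (a : addr) : nat :=
  match a with Dir n => n | Ind j => c_idx c j end.

Definition rd c (a : addr) : R := c_reg c (loc c a).

Definition read_block c (a : addr) (m : nat) : m.-tuple R :=
  [tuple c_reg c (loc c a + i)%N | i < m].

Definition write_block c (a : addr) (s : seq R) : nat -> R := fun n =>
  if (loc c a <= n < loc c a + size s)%N then nth 0 s (n - loc c a)
  else c_reg c n.

(* The oracle receives a point of the span of b through its coordinates.      *)
Definition query_point c (a : addr) : X :=
  lin_comb b (fun i : 'I_k => c_reg c (loc c a + i)%N).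

Definition set_block c (a : addr) (s : seq R) (w : nat) : config X :=
  Config (c_pc c).+1 (write_block c a s) (c_idx c) (c_rand c)
         (c_queries c) (c_ops c + w).

Definition set_idx c (j n : nat) : config X :=
  Config (c_pc c).+1 (c_reg c) [eta c_idx c with j |-> n] (c_rand c)
         (c_queries c) (c_ops c).

Definition goto c (p w : nat) : config X :=
  Config p (c_reg c) (c_idx c) (c_rand c) (c_queries c) (c_ops c + w).

(* Arithmetic operations, comparisons, random numbers, elementary functions   *)
(* and the functions uf count 1; constants, copies, unconditional jumps and   *)
(* index operations are free.                                                 *)
Definition step c : config X :=
  match onth prog (c_pc c) with
  | None => c
  | Some (IConst a x) => set_block c a [:: x] 0
  | Some (ICopy a a1) => set_block c a [:: rd c a1] 0
  | Some (IArith o a a1 a2) =>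
      set_block c a [:: arith_sem o (rd c a1) (rd c a2)] 1
  | Some (IElem e a a1) => set_block c a [:: elem_sem e (rd c a1)] 1
  | Some (IUnit i a a1) =>
      set_block c a (uf_map (read_block c a1 (uf_in (uf i)))) 1
  | Some (IRand a) =>
      Config (c_pc c).+1 (write_block c a [:: u (c_rand c)]) (c_idx c)
             (c_rand c).+1 (c_queries c) (c_ops c).+1
  | Some (IQuery a a1) =>
      Config (c_pc c).+1 (write_block c a [:: f (query_point c a1)]) (c_idx c)
             (c_rand c) (rcons (c_queries c) (query_point c a1)) (c_ops c)
  | Some (IJumpLt a1 a2 p) =>
      goto c (if rd c a1 < rd c a2 then p else (c_pc c).+1) 1
  | Some (IJump p) => goto c p 0
  | Some (IIdxSet j n) => set_idx c j n
  | Some (IIdxSucc j) => set_idx c j (c_idx c j).+1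
  | Some (IIdxPred j) => set_idx c j (c_idx c j).-1
  | Some (IIdxJumpZero j p) =>
      goto c (if c_idx c j == 0%N then p else (c_pc c).+1) 0
  | Some (IHalt _) => c
  end.

Definition init : config X := Config 0 (fun=> 0) (fun=> 0%N) 0 [::] 0.

Definition outputs c (y : R) : Prop :=
  exists2 a, onth prog (c_pc c) = Some (IHalt R I a) & y = rd c a.

Definition halts_with c (y : R) : Prop :=
  (exists n, c = iter n step init) /\ outputs c y.

Definition config_cost c : nat := (k * size (c_queries c) + c_ops c)%N.

End Machine.

(* Taking B j = setT for all j but one gives the marginal distributions; the  *)
(* product rule over all n and B gives independence.                          *)
Definition iid_uniform {R : realType} (d : measure_display)
    (T : measurableType d) (P : probability T R) (U : nat -> T -> R) : Prop :=
  [/\ forall i, measurable_fun [set: T] (U i),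
      forall i w, 0 <= U i w <= 1 &
      forall (n : nat) (B : nat -> set R), (forall i, measurable (B i)) ->
        P (\bigcap_(i < n) (U i @^-1` B i)) =
        (\prod_(i < n) uniform_prob (@ltr01 R) (B i))%E].

(* A realization of the broad sense algorithm A by a program with oracle      *)
(* access to the span of rz_basis: on every w and f the program halts after   *)
(* evaluating f at the nodes of A w, in order, and outputs the value of A.    *)
Record realization {R : realType} {X : completeNormedModType R} {I : Type}
    (uf : I -> unit_fun R) (A : ranalg X) := Realization {
  rz_dim : nat ;
  rz_basis : 'I_rz_dim -> X ;
  rz_indep : lin_indep rz_basis ;
  rz_prog : seq (instr R I) ;
  rz_rand : nat -> ran_T A -> R ;
  rz_uniform : iid_uniform (ran_P A) rz_rand ;
  rz_final : ran_T A -> lip1 X -> config X ;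
  rz_halts : forall w f,
    halts_with uf rz_basis rz_prog f (rz_rand^~ w) (rz_final w f)
      (det_eval (A w) f) ;
  rz_nodes : forall w f, c_queries (rz_final w f) = det_nodes (A w) f }.

(* If uf contains non-measurable functions, the cost may be non-measurable in *)
(* w; the expectation is then the lower integral.                             *)
Definition cost {R : realType} {X : completeNormedModType R} {I : Type}
    (uf : I -> unit_fun R) (A : ranalg X) (r : realization uf A) : \bar R :=
  ereal_sup (range (fun f : lip1 X =>
    ('E_(ran_P A)[fun w => (config_cost (rz_dim r) (rz_final r w f))%:R%R])%E)).

Definition eps_ran {R : realType} {X : completeNormedModType R} {I : Type}
    (uf : I -> unit_fun R) (mu : probability (borelType X) R) (N : nat)
    : \bar R :=
  ereal_inf [set e | exists2 A : ranalg X,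
    exists r : realization uf A, (cost r <= N%:R%:E)%E & e = ran_err mu A].

(* Main.v *)
Require Import Defs.
From mathcomp Require Import all_boot all_order all_algebra.
From mathcomp Require Import all_classical all_reals all_analysis.
From mathcomp Require Import measurable_realfun lra.

Set Implicit Arguments.
Unset Strict Implicit.
Unset Printing Implicit Defensive.

Import Order.TTheory GRing.Theory Num.Theory.
Import numFieldNormedType.Exports.

Local Open Scope classical_set_scope.
Local Open Scope ring_scope.

(** Let A be realized by a program whose oracle sees only a subspace X0 of
    dimension k, at cost at most N, and let n be the cardinality of A.  Two
    things hold.

    Cost: every oracle call costs k, so k times the expected number of calls is
    at most N for every f, and taking the supremum over f gives k * n <= N
    ([realization_card]).

    Error: the distance functional f = dist(., X0) is Lipschitz with constant 1,
    and neither f nor -f can be told apart from 0 by values on X0.  Hence A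
    returns the same random output on f and on -f ([det_eval_agree]), while the
    two integrals are S(f) and -S(f); by the parallelogram identity one of the
    two mean square errors is at least S(f)^2 ([ran_err_ge_quad]).  Since
    S(f) is the average distance to X0, this gives d_k <= e(A)
    ([ran_err_ge_dist]).

    For k > 0 the pair (k, n) therefore witnesses the inequality.  For k = 0 the
    cost does not bound n, but then A only ever evaluates f at the origin.
    Repeated evaluations carry no new information, so an algorithm with a single
    oracle call has the same outputs ([one_query]), and the pair (1, 1) is a
    witness: d_1 <= d_0 because enlarging the subspace decreases distances. *)

(** * Executions that see the same values *)

Section Agreement.
Context {R : realType} {X : completeNormedModType R}.
Implicit Types (A : detalg X) (f g : lip1 X).

Lemma det_obs_agree A f g : {in det_nodes A f, f =1 g} ->
  forall l, (l <= det_card A f)%N -> det_obs A f l = det_obs A g l.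
Proof.
move=> fg; elim=> [//|l IH] lf /=; rewrite -IH; last exact: ltnW.
congr rcons; apply: fg; apply/mapP; exists l => //.
by rewrite mem_iota.
Qed.

(** Only the nodes of f are compared: up to the stopping time of f the two
    executions have the same observations, so g stops then, and not before. *)
Lemma det_card_agree A f g : {in det_nodes A f, f =1 g} ->
  det_card A g = det_card A f.
Proof.
move=> /det_obs_agree; rewrite /det_card.
case: ex_minnP => m Pm minm obs; case: ex_minnP => n Pn minn.
have nm : (n <= m)%N by apply: minn; rewrite -obs.
by apply/eqP; rewrite eqn_leq nm /=; apply: minm; rewrite obs.
Qed.

Lemma det_eval_agree A f g : {in det_nodes A f, f =1 g} ->
  det_eval A g = det_eval A f.
Proof.
by move=> fg; rewrite /det_eval (det_card_agree fg) (det_obs_agree fg).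
Qed.

End Agreement.

(** * Lipschitz functionals *)

Section Lipschitz.
Context {R : realType} {X : completeNormedModType R}.

Lemma lip1N_subproof (f : lip1 X) (x y : X) : `|- f x - - f y| <= `|x - y|.
Proof. by rewrite -opprD normrN lip1P. Qed.

Definition lip1N (f : lip1 X) : lip1 X := Lip1 (lip1N_subproof f).

Lemma lip1_cst_subproof (a : R) (x y : X) : `|a - a| <= `|x - y|.
Proof. by rewrite subrr normr0. Qed.

Definition lip1_cst (a : R) : lip1 X := @Lip1 _ _ (fun=> a) (lip1_cst_subproof a).

Lemma dist_to_ge0 (X0 : set X) x : 0 <= dist_to X0 x.
Proof.
rewrite /dist_to; have [->|/set0P ne] := eqVneq [set `|x - y| | y in X0] set0.
  by rewrite inf0.
by apply: lb_le_inf => // _ [y _ <-].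
Qed.

Lemma dist_to_le {X0 : set X} x {y} : X0 y -> dist_to X0 x <= `|x - y|.
Proof.
by move=> X0y; apply: ge_inf; [exists 0 => _ [z _ <-] | exists y].
Qed.

Lemma le_dist_to (X0 : set X) x r : X0 !=set0 ->
  (forall y, X0 y -> r <= `|x - y|) -> r <= dist_to X0 x.
Proof.
move=> [y X0y] rle; apply: lb_le_inf; first by exists `|x - y|, y.
by move=> _ [z X0z <-]; exact: rle.
Qed.

Lemma dist_to_lip1 (X0 : set X) : X0 !=set0 ->
  forall x y, `|dist_to X0 x - dist_to X0 y| <= `|x - y|.
Proof.
move=> X0n0.
have half x y : dist_to X0 x - dist_to X0 y <= `|x - y|.
  rewrite lerBlDr addrC -lerBlDr; apply: le_dist_to => // z X0z.
  rewrite lerBlDr addrC (le_trans (dist_to_le x X0z))//.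
  by rewrite -(subrKA y) ler_normD.
by move=> x y; rewrite ler_norml half lerNl opprB distrC half.
Qed.

Definition lip1_dist (X0 : set X) (X0n0 : X0 !=set0) : lip1 X :=
  Lip1 (dist_to_lip1 X0n0).

End Lipschitz.

(** * Average widths *)

(** The cost of a program need not be a measurable function of the random
    numbers, so monotonicity is needed for the lower integral. *)
Lemma ge0_le_lower_integral d (T : measurableType d) (R : realType)
    (P : {measure set T -> \bar R}) (f g : T -> \bar R) :
  (forall x, 0 <= f x)%E -> (forall x, f x <= g x)%E ->
  (\int[P]_x f x <= \int[P]_x g x)%E.
Proof.
move=> f0 fg; rewrite !ge0_integralTE// => [|x]; last exact: le_trans (fg x).
apply: ereal_sup_le => _ [h /= hf <-]; exists h => //= x.
exact: le_trans (hf x) (fg x).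
Qed.

Section Widths.
Context {R : realType} {X : completeNormedModType R}.
Variable mu : probability (borelType X) R.

Lemma lin_comb0 k (b : 'I_k -> X) : lin_comb b (fun=> 0) = 0.
Proof. by rewrite /lin_comb big1// => i _; rewrite scale0r. Qed.

Lemma range_lin_comb0 k (b : 'I_k -> X) : range (lin_comb b) 0.
Proof. by exists (fun=> 0) => //; exact: lin_comb0. Qed.

Lemma kwidth_le k (X0 : set X) : subspace_of_dim k X0 ->
  kwidth mu k <= \int[mu]_x dist_to X0 x.
Proof.
move=> X0k; apply: ge_inf; last by exists X0.
by exists 0 => _ [Y _ <-]; apply: Rintegral_ge0 => x _; exact: dist_to_ge0.
Qed.

Hypothesis hmu : (\int[mu]_x (`|x : X|)%:E < +oo)%E.

(** Finiteness of the first moment is what makes the real-valued integral, which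
    is 0 by convention when the integral is infinite, monotone here. *)
Lemma mean_dist_le (X0 Y : set X) : X0 0 -> X0 `<=` Y ->
  \int[mu]_x dist_to Y x <= \int[mu]_x dist_to X0 x.
Proof.
move=> X00 X0Y.
have fin (Z : set X) : Z 0 -> (\int[mu]_x (dist_to Z x)%:E)%E \is a fin_num.
  move=> Z0; rewrite ge0_fin_numE; last first.
    by apply: integral_ge0 => x _; rewrite lee_fin dist_to_ge0.
  apply: le_lt_trans hmu; apply: ge0_le_lower_integral => x; rewrite lee_fin.
    exact: dist_to_ge0.
  by have := dist_to_le x Z0; rewrite subr0.
apply: fine_le; [exact/fin/X0Y | exact: fin |].
apply: ge0_le_lower_integral => x; rewrite lee_fin; first exact: dist_to_ge0.
apply: le_dist_to; first by exists 0.
by move=> y /X0Y; exact: dist_to_le.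
Qed.

(** If X is trivial there is no line, and the width of order 1 is an infimum
    over the empty set, hence 0. *)
Lemma kwidth1_le_dist_origin :
  kwidth mu 1 <= \int[mu]_x dist_to [set 0] x.
Proof.
have [[v v0]|X0] := pselect (exists v : X, v != 0); last first.
  rewrite /kwidth (_ : [set _ | _ in _] = set0) ?inf0.
    by apply: Rintegral_ge0 => x _; exact: dist_to_ge0.
  rewrite -subset0 => y [_ [b bfree _] _]; apply: X0; exists (b ord0).
  apply/eqP => b0; have /eqP := oner_neq0 R; apply.
  apply: (bfree (fun=> 1) _ ord0).
  by rewrite /lin_comb big_ord1 b0 scaler0.
pose b (_ : 'I_1) := v.
apply: (@le_trans _ _ (\int[mu]_x dist_to (range (lin_comb b)) x)).
  apply: kwidth_le; exists b => // c; rewrite /lin_comb big_ord1 => /eqP.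
  by rewrite scaler_eq0 (negbTE v0) orbF => /eqP + i; rewrite (ord1 i).
by apply: mean_dist_le => // _ ->; exact: range_lin_comb0.
Qed.

End Widths.

(** * Lower bound for the error *)

Section Error.
Context {R : realType} {X : completeNormedModType R}.
Variable mu : probability (borelType X) R.
Implicit Type A : ranalg X.

Lemma quadN (f : lip1 X) : (forall x, 0 <= f x) ->
  quad mu (lip1N f) = - quad mu f.
Proof.
move=> f0; rewrite /quad /Rintegral -fineN -integral_ge0N// => x _.
by rewrite lee_fin.
Qed.

Lemma measurable_sqr_err A (f : lip1 X) (s : R) :
  measurable_fun [set: ran_T A] 
    (fun w => `|s - det_eval (A w) f| ^+ 2 : R).
Proof.
apply: measurable_funX; apply: measurableT_comp => //.
by apply: measurable_funB => //; exact: ran_eval_meas.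
Qed.

Lemma ran_err_ge A f :
  (('E_(ran_P A)[fun w => (`|quad mu f - det_eval (A w) f| ^+ 2)%R]) `^ (2^-1)%R
   <= ran_err mu A)%E.
Proof. by apply: ereal_sup_ubound; exists f. Qed.

Lemma ran_err_ge_sqr A f (s : R) : 0 <= s ->
  ((s ^+ 2)%:E <=
    'E_(ran_P A)[fun w => (`|quad mu f - det_eval (A w) f| ^+ 2)%R])%E ->
  (s%:E <= ran_err mu A)%E.
Proof.
move=> s0 sle; apply: le_trans (ran_err_ge A f).
have -> : s%:E = ((s ^+ 2)%:E `^ (2^-1)%R)%E.
  by rewrite poweR_EFin powR12_sqrt ?sqr_ge0// sqrtr_sqr ger0_norm.
have ge0x (x : \bar R) : (0 <= x)%E -> x \in `[0%E, +oo%E].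
  by move=> x0; rewrite in_itv /= x0 leey.
apply: gt0_ler_poweR; rewrite ?ge0x ?invr_ge0//.
  by rewrite lee_fin sqr_ge0.
by apply: le_trans sle; rewrite lee_fin sqr_ge0.
Qed.

(** With s the integral of f and a the common output on f and on -f, the
    identity |s - a|^2 + |-s - a|^2 = 2 s^2 + 2 a^2 shows that the two mean
    square errors add up to at least 2 s^2. *)
Lemma ran_err_ge_quad A (f : lip1 X) : (forall x, 0 <= f x) ->
  (forall w, det_eval (A w) (lip1N f) = det_eval (A w) f) ->
  ((quad mu f)%:E <= ran_err mu A)%E.
Proof.
move=> f0 same; set s := quad mu f.
have s0 : 0 <= s by apply: Rintegral_ge0.
pose E (t : R) := 'E_(ran_P A)[fun w => (`|t - det_eval (A w) f| ^+ 2)%R]%E.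
have Esum : ((s ^+ 2 + s ^+ 2)%:E <= E s + E (- s)%R)%E.
  rewrite /E unlock -ge0_integralD//;
    try exact/measurable_EFinP/measurable_sqr_err;
    try by move=> w _; rewrite lee_fin sqr_ge0.
  rewrite -(expectation_cst (ran_P A)) unlock.
  apply: ge0_le_lower_integral => w /=; rewrite ?lee_fin ?addr_ge0 ?sqr_ge0//.
  rewrite !real_normK ?num_real//; nra.
have [sE|Es] := leP (s ^+ 2)%:E (E s); first exact: ran_err_ge_sqr sE.
apply: (@ran_err_ge_sqr A (lip1N f)) => //.
rewrite (quadN f0) -/s; under eq_fun do rewrite same.
rewrite -/(E (- s)) leNgt; apply/negP => EsN.
by have := lteD Es EsN; rewrite -EFinD ltNge Esum.
Qed.

Lemma ran_err_ge_dist A (X0 : set X) : X0 !=set0 ->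
  (forall w f, {in det_nodes (A w) f, forall x, X0 x}) ->
  ((\int[mu]_x dist_to X0 x)%:E <= ran_err mu A)%E.
Proof.
move=> X0n0 nodes; apply: (@ran_err_ge_quad A (lip1_dist X0n0)) => [x|w].
  exact: dist_to_ge0.
apply: det_eval_agree => x /nodes X0x /=.
suff -> : dist_to X0 x = 0 by rewrite oppr0.
apply/eqP; rewrite eq_le dist_to_ge0 andbT.
by have := dist_to_le x X0x; rewrite subrr normr0.
Qed.

End Error.

(** * Programs *)

Section Programs.
Context {R : realType} {X : completeNormedModType R} {I : Type}.
Context {uf : I -> unit_fun R}.

Lemma step_queries k (b : 'I_k -> X) prog f u (c : config X) :
  {in c_queries c, forall x, range (lin_comb b) x} ->
  {in c_queries (step uf b prog f u c), forall x, range (lin_comb b) x}.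
Proof.
rewrite /step; case: onth => [[]|] //= a a1 qs x.
rewrite mem_rcons inE => /predU1P[->|]; last exact: qs.
by rewrite /query_point; eexists.
Qed.

Lemma realization_nodes (A : ranalg X) (r : realization uf A) w f :
  {in det_nodes (A w) f, forall x, range (lin_comb (@rz_basis _ _ _ _ _ r)) x}.
Proof.
rewrite -(rz_nodes r); have [[n ->] _] := rz_halts r w f.
by elim: n => [//|n IH]; rewrite iterS; exact: step_queries.
Qed.

Lemma realization_card (A : ranalg X) (r : realization uf A) (n N : nat) :
  (0 < rz_dim r)%N -> ran_card A = n%:R%:E -> (cost r <= N%:R%:E)%E ->
  (rz_dim r * n <= N)%N.
Proof.
set k := rz_dim r => k0 cardA costN; have k0R : 0 < k%:R :> R by rewrite ltr0n.
rewrite -(ler_nat R) natrM -ler_pdivlMl// -lee_fin -cardA.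
apply: ge_ereal_sup => _ [f _ <-]; rewrite EFinM lee_pdivlMl//.
apply: le_trans costN; apply: le_trans (ereal_sup_ubound _); last first.
  by exists f.
rewrite unlock -ge0_integralZl ?lee_fin//; first last.
  have mR : measurable_fun [set: nat] (fun n => n%:R : R) by [].
  exact/measurable_EFinP/(measurableT_comp mR (ran_card_meas f)).
apply: ge0_le_lower_integral => w; first by rewrite -EFinM lee_fin mulr_ge0.
rewrite -EFinM lee_fin -natrM ler_nat /config_cost (rz_nodes r).
by rewrite size_map size_iota leq_addr.
Qed.

End Programs.

(** * Algorithms that query only the origin *)

Section OneQuery.
Context {R : realType} {X : completeNormedModType R}.
Variable A : ranalg X.
Implicit Types (w : ran_T A) (f : lip1 X).

(** A functional and the constant functional with its value at 0 are
    indistinguishable at 0, so the output can be recomputed from that value. *)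
Definition one_query_data w : detdata X :=
  DetData 0 (fun=> 0) (fun=> true)
    (fun ys => det_eval (A w) (lip1_cst (head 0 ys))).

Lemma one_query_stop w f : exists l,
  (1 <= l)%N && det_tau (one_query_data w) (det_obs (one_query_data w) f l).
Proof. by exists 1%N. Qed.

Definition one_query_alg w : detalg X := DetAlg (one_query_stop w).

Lemma one_query_card w f : det_card (one_query_alg w) f = 1%N.
Proof.
rewrite /det_card; case: ex_minnP => m /andP[m0 _] min1.
by apply/eqP; rewrite eqn_leq m0 min1.
Qed.

Hypothesis nodes0 : forall w f, {in det_nodes (A w) f, forall x, x = 0}.

Lemma one_query_eval w f : det_eval (one_query_alg w) f = det_eval (A w) f.
Proof.
rewrite /det_eval one_query_card /=; apply: det_eval_agree => x /nodes0 ->.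
by [].
Qed.

Lemma one_query_expected_card : expected_card (ran_P A) one_query_alg = 1%:R%:E.
Proof.
rewrite /expected_card (_ : [set _ | _ in _] = [set 1%:E]) ?ereal_sup1//.
have E1 f : ('E_(ran_P A)[fun w => (det_card (one_query_alg w) f)%:R%R] = 1%:E)%E.
  by under eq_fun do rewrite one_query_card; exact: expectation_cst.
apply/seteqP; split=> [_ [f _ <-]|_ ->]; first exact: E1.
by exists (lip1_cst 0).
Qed.

Lemma one_query_eval_meas f :
  measurable_fun [set: ran_T A] (fun w => det_eval (one_query_alg w) f).
Proof. by under eq_fun do rewrite one_query_eval; exact: ran_eval_meas. Qed.

Lemma one_query_card_meas f :
  measurable_fun [set: ran_T A] (fun w => det_card (one_query_alg w) f).
Proof. by under eq_fun do rewrite one_query_card; exact: measurable_cst. Qed.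

Lemma one_query_card_nat : exists2 n : nat, (1 <= n)%N &
  expected_card (ran_P A) one_query_alg = n%:R%:E.
Proof. by exists 1%N => //; exact: one_query_expected_card. Qed.

Definition one_query : ranalg X :=
  RanAlg one_query_eval_meas one_query_card_meas one_query_card_nat.

Lemma e_ran1_le (mu : probability (borelType X) R) :
  (e_ran mu 1 <= ran_err mu A)%E.
Proof.
apply: ge_ereal_inf; exists (ran_err mu one_query).
  by exists one_query => //; rewrite /ran_card /= one_query_expected_card.
rewrite /ran_err /=; apply: ereal_sup_le => _ [f _ <-]; exists f => //.
by under eq_fun do rewrite -one_query_eval.
Qed.

End OneQuery.

Theorem proposition2 (R : realType) (X : completeNormedModType R)
    (mu : probability (borelType X) R)
    (hmu : (\int[mu]_x (`|x : X|)%:E < +oo)%E)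
    (I : Type) (uf : I -> unit_fun R)
    (N : nat) (hN : (1 <= N)%N) :
  (ereal_inf [set maxe (e_ran mu kn.2) (kwidth mu kn.1)%:E |
      kn in [set kn : nat * nat |
        [/\ (1 <= kn.1)%N, (1 <= kn.2)%N & (kn.1 * kn.2 <= N)%N]]]
   <= eps_ran uf mu N)%E.
Proof.
apply: le_ereal_inf_tmp => _ [A [r costN] ->].
have nodes := realization_nodes r.
have X0n0 : range (lin_comb (@rz_basis _ _ _ _ _ r)) !=set0.
  by exists 0; exact: range_lin_comb0.
have dist_err := ran_err_ge_dist mu X0n0 nodes.
have [k0|k0] := posnP (rz_dim r).
  have X00 : range (lin_comb (@rz_basis _ _ _ _ _ r)) = [set 0].
    apply/seteqP; split=> [_ [c _ <-]|_ ->]; last exact: range_lin_comb0.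
    by rewrite /lin_comb big1// => i _; have := ltn_ord i;
      rewrite [X in (_ < X)%N]k0.
  rewrite X00 in dist_err nodes.
  apply: ge_ereal_inf; exists (maxe (e_ran mu 1) (kwidth mu 1)%:E).
    by exists (1, 1)%N.
  rewrite ge_max (e_ran1_le nodes)/=; apply: le_trans dist_err.
  by rewrite lee_fin kwidth1_le_dist_origin.
have [n n1 cardA] := ran_card_nat A.
apply: ge_ereal_inf; exists (maxe (e_ran mu n) (kwidth mu (rz_dim r))%:E).
  by exists (rz_dim r, n) => //; split=> //; exact: realization_card costN.
rewrite ge_max; apply/andP; split.
  by apply: ge_ereal_inf; exists (ran_err mu A) => //; exists A => //;
    rewrite /ran_card cardA.
apply: le_trans dist_err; rewrite lee_fin; apply: kwidth_le.
by exists (@rz_basis _ _ _ _ _ r) => //; exact: rz_indep.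
Qed.
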